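(* The following is provable in $\mathrm{BZFC}$: for all sets $A$, $B$ and $C$, 1. $A\cong A$; 2. $A\cong B\Leftrightarrow B\cong A$; 3. if $A\cong B$, then $A\cong C\Leftrightarrow B\cong C$; 4. if $A\cong B$, then $A\preceq C\Leftrightarrow B\preceq C$; 5. if $A\cong B$, then $C\preceq A\Leftrightarrow C\preceq B$; 6. if $A\preceq B$ and $B\preceq C$, then $A\preceq C$.
   Context: Logic. The background logic is the four-valued first-order logic BS4 with primitives $\sim,\land,\lor,\rightarrow,\leftrightarrow,\bot,\forall,\exists$. A model has a non-empty domain $M$, the usual interpretations of constants and function symbols, and, for each $n$-ary relation symbol $R$, two independent interpretations $R^+,R^-\subseteq M^n$; $=^+$ is true identity and $=^-$ is a symmetric relation. Truth and falsity are defined simultaneously (a formula may be true, false, both, or neither): an atomic formula is true/false according to $R^+$/$R^-$; $\sim\varphi$ is true iff $\varphi$ is false, and false iff $\varphi$ is true; $\varphi\land\psi$ is true iff both are true, false iff at least one is false; $\lor$ dually; $\varphi\rightarrow\psi$ is true iff ($\varphi$ true implies $\psi$ true), false iff $\varphi$ is true and $\psi$ is false; $\varphi\leftrightarrow\psi$ is true iff ($\varphi$ true iff $\psi$ true), false iff ($\varphi$ true and $\psi$ false) or ($\varphi$ false and $\psi$ true); $\forall$ is true iff all instances are true, false iff some instance is false; $\exists$ is true iff some instance is true, false iff all instances are false; $\bot$ is false and not true. $\Gamma\vDash\varphi$ iff $\varphi$ is true in every model in which all of $\Gamma$ is true. Asserting a formula means asserting that it is true; English ''iff'', ''if/then'',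 ''and'', ''or'' between formulas concern truth. Abbreviations: $\neg\varphi:=\varphi\rightarrow\bot$ (true iff $\varphi$ is not true); $!\varphi:=\sim\neg\varphi$ (two-valued, true iff $\varphi$ is true); $?\varphi:=\neg\sim\varphi$ (two-valued, true iff $\varphi$ is not false); $\circ\varphi:=\,!\varphi\leftrightarrow ?\varphi$; $\varphi\Rightarrow\psi:=(\varphi\rightarrow\psi)\land(\sim\psi\rightarrow\sim\varphi)$; $\varphi\Leftrightarrow\psi:=(\varphi\leftrightarrow\psi)\land(\sim\varphi\leftrightarrow\sim\psi)$; $\varphi\,\&\,\psi:=\,\sim(\varphi\rightarrow\sim\psi)$; $\exists x\in A\,\varphi:=\exists x(x\in A\,\&\,\varphi)$; $\forall x\in A\,\varphi:=\forall x(x\in A\rightarrow\varphi)$. A slashed relation symbol ($\neq,\notin,\not\subseteq,\not\cong,\not\preceq$) is the $\sim$-negation of the relation. Set theory. $\mathrm{BZFC}$ is a BS4-theory in the language $\{\in,=\}$ whose objects are called sets. It includes: Extensionality $\forall A\forall B(A=B\Leftrightarrow\forall x(x\in A\Leftrightarrow x\in B))$; Comprehension $\forall A\exists B\forall x(x\in B\Leftrightarrow x\in A\land\varphi(x))$; ACLA: $\exists A(A^!\not\subseteq A^?)\land\exists A(A^?\not\subseteq A^!)$; Choice: every classical set of non-empty sets has a choice function. Here $A=\{x:\varphi(x)\}$ means $\forall x(x\in A\Leftrightarrow\varphi(x))$; $A\subseteq B:=\forall x(x\in A\Rightarrow x\in B)$; $A$ is classical if $\forall x\,{\circ}(x\in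 A)$; $A^!:=\{x:{!}(x\in A)\}$ and $A^?:=\{x:{?}(x\in A)\}$. The remaining axioms are suitable analogues of those of $\mathrm{ZFC}$; available consequences are: $A^!,A^?$ are (classical) sets; $A\subseteq B\leftrightarrow(A^!\subseteq B^!\land A^?\subseteq B^?)$, $A\not\subseteq B\leftrightarrow A^!\not\subseteq B^?$, $A=B\leftrightarrow(A^!=B^!\land A^?=B^?)$, $A\neq B\leftrightarrow(A^!\not\subseteq B^?\lor B^!\not\subseteq A^?)$; for all classical sets $X,Y$ there is a unique set $\langle X|Y\rangle$ with $\langle X|Y\rangle^!=X$, $\langle X|Y\rangle^?=Y$; ordered pairs are encoded so that $(a,b)=(c,d)\Leftrightarrow(a=c\land b=d)$; usual $\mathrm{ZFC}$ set theory (including choice and von Neumann ordinals, which live in the inner $\mathrm{ZFC}$-model of hereditarily classical sets) applies to classical sets, whose elements may be arbitrary sets. Put $\mathrm{rlm}(A):=A^!\cup A^?$ (a classical set). Functions and equinumerosity. A classical function is a classical set $f$ of ordered pairs with $((a,b)\in f\land(a,c)\in f)\rightarrow{!}(b=c)$; it is an injection if $((a,c)\in f\land(b,c)\in f)\rightarrow{!}(a=b)$. For $A\subseteq\mathrm{dom}(f)$, $f[A]:=\{y:\exists x(y=f(x)\,\&\,x\in A)\}$, so $f[A]^!=f[A^!]$ and $f[A]^?=f[A^?]$. A counting of $A$ is an injection with domain $\mathrm{rlm}(A)$; $\mathrm{Count}(A)$ is the class of countings of $A$. Define $$A\cong B:=\exists f\in\mathrm{Count}(A)\,\exists g\in\mathrm{Count}(B)\,(f[A]=g[B]),$$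 $$A\preceq B:=\exists f\in\mathrm{Count}(A)\,\exists g\in\mathrm{Count}(B)\,(f[A]\subseteq g[B]).$$ Thus $A\not\cong B$ (resp. $A\not\preceq B$) is true iff $f[A]\neq g[B]$ (resp. $f[A]\not\subseteq g[B]$) is true for all $f\in\mathrm{Count}(A)$, $g\in\mathrm{Count}(B)$. *)

(* Defs.v *)
(** * The logic BS4 over the language {∈, =} *)

(** De Bruijn syntax: a variable is an index, [All] and [Ex] bind index 0, and
    the free variables of a subformula are shifted by one under each binder. *)
Inductive form : Type :=
| Mem (x y : nat)
| Eq (x y : nat)
| Bot
| Not (p : form)
| And (p q : form)
| Or (p q : form)
| Imp (p q : form)
| Iff (p q : form)
| All (p : form)
| Ex (p : form).

(** [=^+] is true identity, so only [=^-] is part of the data. *)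
Record model : Type := Model {
  dom :> Type;
  dom_inhabited : inhabited dom;
  mem_pos : dom -> dom -> Prop;
  mem_neg : dom -> dom -> Prop;
  eq_neg : dom -> dom -> Prop;
  eq_neg_sym : forall a b, eq_neg a b -> eq_neg b a
}.

Definition scons {T : Type} (d : T) (e : nat -> T) (n : nat) : T :=
  match n with O => d | S m => e m end.

Fixpoint sat_true (M : model) (e : nat -> M) (p : form) {struct p} : Prop :=
  match p with
  | Mem x y => mem_pos M (e x) (e y)
  | Eq x y => e x = e y
  | Bot => False
  | Not p => sat_false M e p
  | And p q => sat_true M e p /\ sat_true M e q
  | Or p q => sat_true M e p \/ sat_true M e q
  | Imp p q => sat_true M e p -> sat_true M e q
  | Iff p q => sat_true M e p <-> sat_true M e q
  | All p => forall d : M, sat_true M (scons d e) p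
  | Ex p => exists d : M, sat_true M (scons d e) p
  end
with sat_false (M : model) (e : nat -> M) (p : form) {struct p} : Prop :=
  match p with
  | Mem x y => mem_neg M (e x) (e y)
  | Eq x y => eq_neg M (e x) (e y)
  | Bot => True
  | Not p => sat_true M e p
  | And p q => sat_false M e p \/ sat_false M e q
  | Or p q => sat_false M e p /\ sat_false M e q
  | Imp p q => sat_true M e p /\ sat_false M e q
  | Iff p q => (sat_true M e p /\ sat_false M e q) \/
               (sat_false M e p /\ sat_true M e q)
  | All p => exists d : M, sat_false M (scons d e) p
  | Ex p => forall d : M, sat_false M (scons d e) p
  end.

(** Formulas with free variables are read as their universal closures; this is
    how the parameters of the axiom schemata below are quantified. *)
Definition valid_in (M : model) (p : form) : Prop :=
  forall e : nat -> M, sat_true M e p.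

Definition entails (T : form -> Prop) (p : form) : Prop :=
  forall M : model, (forall q, T q -> valid_in M q) -> valid_in M p.

(** Renaming of free variables. *)
Definition up (r : nat -> nat) (n : nat) : nat :=
  match n with O => O | S m => S (r m) end.

Fixpoint ren (r : nat -> nat) (p : form) : form :=
  match p with
  | Mem x y => Mem (r x) (r y)
  | Eq x y => Eq (r x) (r y)
  | Bot => Bot
  | Not p => Not (ren r p)
  | And p q => And (ren r p) (ren r q)
  | Or p q => Or (ren r p) (ren r q)
  | Imp p q => Imp (ren r p) (ren r q)
  | Iff p q => Iff (ren r p) (ren r q)
  | All p => All (ren (up r) p)
  | Ex p => Ex (ren (up r) p)
  end.

(** ** Defined connectives *)

Definition neg (p : form) : form := Imp p Bot.
Definition bang (p : form) : form := Not (neg p).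
Definition quest (p : form) : form := neg (Not p).
Definition circ (p : form) : form := Iff (bang p) (quest p).
Definition SImp (p q : form) : form := And (Imp p q) (Imp (Not q) (Not p)).
Definition SIff (p q : form) : form := And (Iff p q) (Iff (Not p) (Not q)).
(** [φ & ψ], true iff both are true, but false iff [φ] true implies [ψ] false;
    written [⊗] since [&] is a reserved token. *)
Definition Amp (p q : form) : form := Not (Imp p (Not q)).

Declare Scope bs4_scope.
Delimit Scope bs4_scope with bs4.
Bind Scope bs4_scope with form.
Notation "x ∈ y" := (Mem x y) (at level 70, no associativity) : bs4_scope.
Notation "x ≐ y" := (Eq x y) (at level 70, no associativity) : bs4_scope.
Notation "∼ p" := (Not p) (at level 75, right associativity) : bs4_scope.
Notation "p ∧ q" := (And p q) (at level 80, right associativity) : bs4_scope.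
Notation "p ⊗ q" := (Amp p q) (at level 80, right associativity) : bs4_scope.
Notation "p ∨ q" := (Or p q) (at level 85, right associativity) : bs4_scope.
Notation "p ↔ q" := (Iff p q) (at level 95, no associativity) : bs4_scope.
Notation "p ⇔ q" := (SIff p q) (at level 95, no associativity) : bs4_scope.
Notation "p → q" := (Imp p q)
  (at level 99, q at level 200, right associativity) : bs4_scope.
Notation "p ⇒ q" := (SImp p q)
  (at level 99, q at level 200, right associativity) : bs4_scope.
Local Open Scope bs4_scope.

(** * Set-theoretic vocabulary *)

(** The arguments [u a b f ...] below are variables of the ambient context. *)

Definition subset (a b : nat) : form := All (0 ∈ S a ⇒ 0 ∈ S b).

Definition classical (a : nat) : form := All (circ (0 ∈ S a)).

(** [u = {x : p}], where index 0 of [p] is [x] and the ambient variables,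
    [u] included, occur shifted by one in [p]. *)
Definition set_eq (u : nat) (p : form) : form := All (0 ∈ S u ⇔ p).

(** Set terms are eliminated contextually: [q] holds of [{x : p}], where index 0
    of [q] is that set, and index 0 of [p] is [x]. *)
Definition skip1 (n : nat) : nat :=
  match n with O => O | S m => S (S m) end.
Definition let_set (p q : form) : form := Ex (set_eq 0 (ren skip1 p) ⊗ q).

Definition in_bang (x a : nat) : form := bang (x ∈ a).
Definition in_quest (x a : nat) : form := quest (x ∈ a).
Definition in_rlm (x a : nat) : form := in_bang x a ∨ in_quest x a.

Definition is_empty (u : nat) : form := set_eq u Bot.

(** [u = {a, b}].  The [bang]s are essential: [{x : x = a}] need not be a set,
    because [x = a] can fail to be false for a proper class of [x]. *)
Definition is_upair (u a b : nat) : form :=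
  set_eq u (bang (0 ≐ S a) ∨ bang (0 ≐ S b)).

(** [x = {{y}, ∅}] and [x = {{y}}], two injective tags with disjoint ranges. *)
Definition is_ltag (x y : nat) : form :=
  Ex (is_upair 0 (S y) (S y) ∧ Ex (is_empty 0 ∧ is_upair (S (S x)) 1 0)).
Definition is_rtag (x y : nat) : form :=
  Ex (is_upair 0 (S y) (S y) ∧ is_upair (S x) 0 0).

(** [p = (a, b)], encoded as the disjoint union
    [{x : ∃y (x = {{y}, ∅} & y ∈ a) ∨ ∃y (x = {{y}} & y ∈ b)}].  The Kuratowski
    and Wiener pairs, being classical sets, would only give
    [(a, b) = (c, d) ↔ (a = c ∧ b = d)]; here [p^!] and [p^?] are the disjoint
    unions of [a^!], [b^!] and of [a^?], [b^?], which gives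
    [(a, b) = (c, d) ⇔ (a = c ∧ b = d)]. *)
Definition is_pair (p a b : nat) : form :=
  set_eq p (Ex (is_ltag 1 0 ⊗ 0 ∈ S (S a)) ∨ Ex (is_rtag 1 0 ⊗ 0 ∈ S (S b))).

(** [(a, b) ∈ f]. *)
Definition pair_in (a b f : nat) : form :=
  Ex (is_pair 0 (S a) (S b) ⊗ 0 ∈ S f).

Definition is_function (f : nat) : form :=
  classical f
  ∧ All (0 ∈ S f → Ex (Ex (is_pair 2 1 0)))
  ∧ All (All (All (pair_in 2 1 (3 + f) ∧ pair_in 2 0 (3 + f)
                   → bang (1 ≐ 0)))).

Definition is_injection (f : nat) : form :=
  is_function f
  ∧ All (All (All (pair_in 2 0 (3 + f) ∧ pair_in 1 0 (3 + f)
                   → bang (2 ≐ 1)))).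

(** [d = dom(f)]. *)
Definition is_dom (d f : nat) : form := set_eq d (Ex (pair_in 1 0 (2 + f))).

(** [f ∈ Count(a)]. *)
Definition is_counting (f a : nat) : form :=
  is_injection f ∧ Ex (set_eq 0 (in_rlm 0 (2 + a)) ∧ is_dom 0 (S f)).

(** [y ∈ f[a]], i.e. [∃x (y = f(x) & x ∈ a)]. *)
Definition in_image (y f a : nat) : form :=
  Ex (pair_in 0 (S y) (S f) ⊗ 0 ∈ S a).

(** [∃f ∈ Count(a) ∃g ∈ Count(b) R(f[a], g[b])]; in [R], the set [f[a]] is
    index 1 and [g[b]] is index 0. *)
Definition compare (R : form) (a b : nat) : form :=
  Ex (is_counting 0 (S a) ⊗
  Ex (is_counting 0 (2 + b) ⊗
    let_set (in_image 0 2 (3 + a))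
      (let_set (in_image 0 2 (4 + b)) R))).

Definition equinum (a b : nat) : form := compare (1 ≐ 0) a b.
Definition dominated (a b : nat) : form := compare (subset 1 0) a b.

Notation "a ≅ b" := (equinum a b) (at level 70, no associativity) : bs4_scope.
Notation "a ⪯ b" := (dominated a b) (at level 70, no associativity) : bs4_scope.

(** * The theory BZFC *)

(** ∀A ∀B (A = B ⇔ ∀x (x ∈ A ⇔ x ∈ B)) *)
Definition ax_extensionality : form :=
  All (All (1 ≐ 0 ⇔ All (0 ∈ 2 ⇔ 0 ∈ 1))).

(** ∀A ∃B ∀x (x ∈ B ⇔ x ∈ A ∧ φ(x)); in [p], index 0 is [x], index 1 is [A] and
    the remaining ones are parameters. *)
Definition ax_comprehension (p : form) : form :=
  All (Ex (set_eq 0 (0 ∈ 2 ∧ ren skip1 p))).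

(** ∀A ∃C (C classical ∧ A ⊆ C) *)
Definition ax_classical_superset : form :=
  All (Ex (classical 0 ∧ subset 1 0)).

(** ∀a ∀b ∃u (u = {a, b}) *)
Definition ax_pairing : form := All (All (Ex (is_upair 0 2 1))).

(** ∀A ∃U ∀x (x ∈ U ⇔ ∃z (z ∈ A ∧ x ∈ z)) *)
Definition ax_union : form := All (Ex (set_eq 0 (Ex (0 ∈ 3 ∧ 1 ∈ 0)))).

(** ∀A ∃P ∀x (x ∈ P ⇔ !(x ⊆ A)); without [bang] this could be a proper class. *)
Definition ax_powerset : form := All (Ex (set_eq 0 (bang (subset 0 2)))).

(** ∃W (∅ ∈ W ∧ ∀y (y ∈ W → y ∪ {y} ∈ W)) *)
Definition ax_infinity : form :=
  Ex (Ex (is_empty 0 ∧ 0 ∈ 1)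
      ∧ All (0 ∈ 1 → Ex (set_eq 0 (0 ∈ 2 ∨ bang (0 ≐ 2)) ∧ 0 ∈ 2))).

(** ∀x ∀y ∀z (φ(x, y) ∧ φ(x, z) → y = z) →
      ∀A ∃B ∀y (y ∈ B ⇔ ∃x (x ∈ A ∧ !φ(x, y)));
    in [p], index 0 is [y], index 1 is [x], the remaining ones are parameters.
    The renamings yield [φ(x, y)] and [φ(x, z)] under the binders [x, y, z], and
    [φ(x, y)] under the binders [A, B, y, x]. *)
Definition repl_img (n : nat) : nat :=
  match n with O => 1 | S O => 0 | S (S m) => 4 + m end.
Definition ax_replacement (p : form) : form :=
  All (All (All (ren S p ∧ ren skip1 p → 1 ≐ 0)))
  → All (Ex (set_eq 0 (Ex (0 ∈ 3 ∧ bang (ren repl_img p))))).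

(** Every [A] with [A^!] non-empty has some [x ∈ A] such that no [y ∈ A] is in
    [rlm(x)]. *)
Definition ax_foundation : form :=
  All (Ex (0 ∈ 1) → Ex (0 ∈ 1 ∧ All (0 ∈ 2 → neg (in_rlm 0 1)))).

(** ∃A (A^! ⊈ A^?) ∧ ∃A (A^? ⊈ A^!) *)
Definition ax_acla : form :=
  Ex (let_set (in_bang 0 1) (let_set (in_quest 0 2) (∼ subset 1 0)))
  ∧ Ex (let_set (in_bang 0 1) (let_set (in_quest 0 2) (∼ subset 0 1))).

(** Every classical set [u] of non-empty sets has a function [f] with domain [u]
    such that [f(x) ∈ x] for all [x ∈ u]. *)
Definition ax_choice : form :=
  All (classical 0 ∧ All (0 ∈ 1 → Ex (0 ∈ 1))
       → Ex (is_function 0 ∧ is_dom 1 0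
             ∧ All (All (pair_in 1 0 2 → 0 ∈ 1)))).

Inductive BZFC : form -> Prop :=
| BZFC_extensionality : BZFC ax_extensionality
| BZFC_comprehension p : BZFC (ax_comprehension p)
| BZFC_classical_superset : BZFC ax_classical_superset
| BZFC_pairing : BZFC ax_pairing
| BZFC_union : BZFC ax_union
| BZFC_powerset : BZFC ax_powerset
| BZFC_infinity : BZFC ax_infinity
| BZFC_replacement p : BZFC (ax_replacement p)
| BZFC_foundation : BZFC ax_foundation
| BZFC_acla : BZFC ax_acla
| BZFC_choice : BZFC ax_choice.

(* Main.v *)
(** Suppose countings [f] of [A] and [g] of [B] satisfy [f[A] ⊆ g[B]].  Then
    [f] maps [rlm(A)] into [g[rlm(B)]], so every counting [h] of [B] can be
    pulled back to the counting [h ∘ g⁻¹ ∘ f] of [A], whose image of [A] is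
    contained in [h[B]], and equal to it if [f[A] = g[B]].  Hence equinumerous
    sets have the same images under countings, which transports the truth as
    well as the falsity of [A ≅ C], [A ⪯ C] and [C ⪯ A], since falsity
    quantifies over all countings.  Transitivity of [⪯] is the case of a
    mere inclusion. *)
Require Import Defs.
From Stdlib Require Import Classical.
Local Open Scope bs4_scope.

(** * Renaming of variables and satisfaction *)

Lemma sat_ren (M : model) (p : form) :
  forall (r : nat -> nat) (e e' : nat -> M), (forall n, e' n = e (r n)) ->
    (sat_true M e (ren r p) <-> sat_true M e' p) /\
    (sat_false M e (ren r p) <-> sat_false M e' p).
Proof.
  assert (Hup : forall (r : nat -> nat) (e e' : nat -> M) d,
    (forall n, e' n = e (r n)) -> forall n, scons d e' n = scons d e (up r n))
    by (intros r e e' d He [|n]; simpl; auto).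
  (* Truth and falsity go through a single induction because [Not] exchanges them. *)
  induction p as [x y|x y| |p IH|p IHp q IHq|p IHp q IHq|p IHp q IHq|p IHp q IHq
    |p IH|p IH]; intros r e e' He; simpl;
    try (rewrite ?He; tauto);
    try (specialize (IH r e e' He); tauto);
    try (specialize (IHp r e e' He); specialize (IHq r e e' He); tauto);
    assert (IH' := fun d => IH (up r) _ _ (Hup r e e' d He));
    firstorder.
Qed.

(** * The axioms of BZFC as statements about a model *)

Section InModel.

Context (M : model) (HM : forall q, BZFC q -> valid_in M q).

Notation "x ∈⁺ a" := (mem_pos M x a) (at level 70).
Notation "x ∈⁻ a" := (mem_neg M x a) (at level 70).

Lemma mem_ext (a b : M) :
  (forall x, (x ∈⁺ a <-> x ∈⁺ b) /\ (x ∈⁻ a <-> x ∈⁻ b)) -> a = b.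
Proof.
  exact (proj2 (proj1 (HM _ BZFC_extensionality (fun _ => a) a b))).
Qed.

(** The falsity half of Extensionality. Both conjuncts of a [⇔] are false in the same two cases,
    which leaves one disjunction. *)
Lemma eq_neg_mem (a b : M) :
  eq_neg M a b <-> exists x, (x ∈⁺ a /\ x ∈⁻ b) \/ (x ∈⁻ a /\ x ∈⁺ b).
Proof.
  rewrite (proj2 (HM _ BZFC_extensionality (fun _ => a) a b)); simpl.
  split; intros [x Hx]; exists x; tauto.
Qed.

Lemma comprehension (p : form) (e : nat -> M) (a : M) :
  exists b, forall x,
    (x ∈⁺ b <-> x ∈⁺ a /\ sat_true M (scons x (scons a e)) p) /\
    (x ∈⁻ b <-> x ∈⁻ a \/ sat_false M (scons x (scons a e)) p).
Proof.
  destruct (HM _ (BZFC_comprehension p) e a) as [b Hb]; exists b; intros x.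
  destruct (Hb x) as [Hp Hn]; simpl in Hp, Hn.
  destruct (sat_ren M p skip1 (scons x (scons b (scons a e)))
    (scons x (scons a e))) as [Rp Rn]; [intros [|n]; reflexivity|].
  rewrite <- Rp, <- Rn; split; assumption.
Qed.

(** The [bang] in the axiom makes the relation two-valued, so for falsity only the [x] related to
    [y] put a demand on [a]. *)
Lemma replacement (p : form) (e : nat -> M) (a : M) :
  (forall x y z, sat_true M (scons y (scons x e)) p ->
    sat_true M (scons z (scons x e)) p -> y = z) ->
  exists b, forall y,
    (y ∈⁺ b <-> exists x, x ∈⁺ a /\ sat_true M (scons y (scons x e)) p) /\
    (y ∈⁻ b <-> forall x, sat_true M (scons y (scons x e)) p -> x ∈⁻ a).
Proof.
  intros Hfun.
  assert (H := HM _ (BZFC_replacement p) e); simpl in H.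
  destruct (H) with (d := a) as [b Hb].
  - intros x y z [Hy Hz]; apply (Hfun x).
    + revert Hy; apply sat_ren; intros [|[|n]]; reflexivity.
    + revert Hz; apply sat_ren; intros [|[|n]]; reflexivity.
  - exists b; intros y; destruct (Hb y) as [Hp Hn].
    assert (R : forall x,
      sat_true M (scons x (scons y (scons b (scons a e)))) (ren repl_img p) <->
      sat_true M (scons y (scons x e)) p)
      by (intros x; apply sat_ren; intros [|[|n]]; reflexivity).
    split.
    + rewrite Hp; split; intros [x Hx]; exists x; specialize (R x); tauto.
    + rewrite Hn; split; intros Hx x; specialize (R x); specialize (Hx x); tauto.
Qed.

(** * Unordered pairs, tags and ordered pairs *)

Definition env3 (a b c : M) : nat -> M := scons a (scons b (fun _ => c)).

Definition empty (u : M) : Prop := forall x, (x ∈⁺ u <-> False) /\ (x ∈⁻ u <-> True).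

(** Stated through [sat_true] so that all the predicates below are convertible
    to the satisfaction of the formulas they interpret. *)
Definition upair (u a b : M) : Prop := sat_true M (env3 u a b) (is_upair 0 1 2).

Definition ltag (x y : M) : Prop :=
  exists s, upair s y y /\ exists o, empty o /\ upair x s o.

Definition rtag (x y : M) : Prop := exists s, upair s y y /\ upair x s s.

(** The falsity clause mentions only the truth of the tags, because [φ ⊗ ψ] is false exactly when
    truth of [φ] implies falsity of [ψ]. *)
Definition pair (p a b : M) : Prop := forall x,
  (x ∈⁺ p <-> (exists y, ltag x y /\ y ∈⁺ a) \/ (exists y, rtag x y /\ y ∈⁺ b)) /\
  (x ∈⁻ p <-> (forall y, ltag x y -> y ∈⁻ a) /\ (forall y, rtag x y -> y ∈⁻ b)).

Definition maps (f x y : M) : Prop := exists p, pair p x y /\ p ∈⁺ f.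

Definition rlm (x a : M) : Prop := x ∈⁺ a \/ ~ x ∈⁻ a.

(** The [bang]s in [is_upair] turn falsity of membership into plain distinctness, so [eq_neg]
    disappears. *)
Lemma upairP (u a b : M) :
  upair u a b <->
  forall x, (x ∈⁺ u <-> x = a \/ x = b) /\ (x ∈⁻ u <-> x <> a /\ x <> b).
Proof.
  unfold upair; simpl; split; intros H x; specialize (H x); simpl in H; tauto.
Qed.

Lemma upair_exists (a b : M) : exists u, upair u a b.
Proof. exact (HM _ BZFC_pairing (fun _ => a) a b). Qed.

Lemma upair_unique (u v a b : M) : upair u a b -> upair v a b -> u = v.
Proof.
  rewrite !upairP; intros Hu Hv; apply mem_ext; intros x.
  specialize (Hu x); specialize (Hv x); tauto.
Qed.

Lemma upair_singleton_inj (s a b : M) : upair s a a -> upair s b b -> a = b.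
Proof.
  rewrite !upairP; intros Ha Hb.
  destruct (Ha a) as [Haa _]; destruct (Hb a) as [Hab _]; tauto.
Qed.

Lemma empty_exists : exists u, empty u.
Proof.
  destruct (dom_inhabited M) as [a].
  destruct (comprehension Bot (fun _ => a) a) as [u Hu]; exists u; intros x.
  specialize (Hu x); simpl in Hu; tauto.
Qed.

Lemma empty_unique (u v : M) : empty u -> empty v -> u = v.
Proof.
  intros Hu Hv; apply mem_ext; intros x.
  specialize (Hu x); specialize (Hv x); tauto.
Qed.

Lemma singleton_not_empty (s a : M) : upair s a a -> ~ empty s.
Proof.
  rewrite upairP; intros Hs He; specialize (Hs a); specialize (He a); tauto.
Qed.

Lemma ltag_exists (y : M) : exists x, ltag x y.
Proof.
  destruct (upair_exists y y) as [s Hs]; destruct empty_exists as [o Ho].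
  destruct (upair_exists s o) as [x Hx]; exists x, s; eauto.
Qed.

Lemma rtag_exists (y : M) : exists x, rtag x y.
Proof.
  destruct (upair_exists y y) as [s Hs].
  destruct (upair_exists s s) as [x Hx]; exists x, s; eauto.
Qed.

Lemma ltag_unique (x x' y : M) : ltag x y -> ltag x' y -> x = x'.
Proof.
  intros (s & Hs & o & Ho & Hx) (s' & Hs' & o' & Ho' & Hx').
  rewrite (upair_unique s' s y y Hs' Hs), (empty_unique o' o Ho' Ho) in Hx'.
  exact (upair_unique x x' s o Hx Hx').
Qed.

Lemma rtag_unique (x x' y : M) : rtag x y -> rtag x' y -> x = x'.
Proof.
  intros (s & Hs & Hx) (s' & Hs' & Hx').
  rewrite (upair_unique s' s y y Hs' Hs) in Hx'.
  exact (upair_unique x x' s s Hx Hx').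
Qed.

Lemma ltag_inj (x y y' : M) : ltag x y -> ltag x y' -> y = y'.
Proof.
  intros (s & Hs & o & Ho & Hx) (s' & Hs' & o' & Ho' & Hx').
  rewrite upairP in Hx, Hx'.
  (* The singleton [s] of [y] is a member of [x], hence the other singleton or the empty set; a
     singleton is not empty. *)
  assert (E : s = s' \/ s = o') by (apply Hx', Hx; auto).
  destruct E as [->| ->].
  - exact (upair_singleton_inj s' y y' Hs Hs').
  - destruct (singleton_not_empty o' y Hs Ho').
Qed.

Lemma rtag_inj (x y y' : M) : rtag x y -> rtag x y' -> y = y'.
Proof.
  intros (s & Hs & Hx) (s' & Hs' & Hx').
  rewrite (upair_singleton_inj x s s' Hx Hx') in Hs.
  exact (upair_singleton_inj s' y y' Hs Hs').
Qed.

(** A left tag has the empty set as a member, whereas the only member of a right tag is a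
    singleton. *)
Lemma ltag_not_rtag (x y y' : M) : ltag x y -> ~ rtag x y'.
Proof.
  intros (s & Hs & o & Ho & Hx) (s' & Hs' & Hx').
  rewrite upairP in Hx, Hx'.
  assert (E : o = s' \/ o = s') by (apply Hx', Hx; auto).
  apply (singleton_not_empty s' y' Hs'); destruct E as [<-| <-]; exact Ho.
Qed.

Lemma pair_unique (p q a b : M) : pair p a b -> pair q a b -> p = q.
Proof.
  intros Hp Hq; apply mem_ext; intros x; destruct (Hp x), (Hq x).
  split; etransitivity; try eassumption; symmetry; assumption.
Qed.

(** Injectivity and disjointness of the tags let [t] speak about [y] alone, so the first component
    can be decoded in both truth values. *)
Lemma pair_ltag (p a b t y : M) : pair p a b -> ltag t y ->
  (t ∈⁺ p <-> y ∈⁺ a) /\ (t ∈⁻ p <-> y ∈⁻ a).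
Proof.
  intros Hp Ht; destruct (Hp t) as [-> ->]; split; split.
  - intros [(y' & Hy' & Ha)|(y' & Hy' & _)].
    + rewrite (ltag_inj t y y'); assumption.
    + destruct (ltag_not_rtag t y y' Ht Hy').
  - intros Ha; left; eauto.
  - intros [Ha _]; auto.
  - intros Ha; split; intros y' Hy'.
    + rewrite (ltag_inj t y' y); assumption.
    + destruct (ltag_not_rtag t y y' Ht Hy').
Qed.

Lemma pair_rtag (p a b t y : M) : pair p a b -> rtag t y ->
  (t ∈⁺ p <-> y ∈⁺ b) /\ (t ∈⁻ p <-> y ∈⁻ b).
Proof.
  intros Hp Ht; destruct (Hp t) as [-> ->]; split; split.
  - intros [(y' & Hy' & _)|(y' & Hy' & Hb)].
    + destruct (ltag_not_rtag t y' y Hy' Ht).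
    + rewrite (rtag_inj t y y'); assumption.
  - intros Hb; right; eauto.
  - intros [_ Hb]; auto.
  - intros Hb; split; intros y' Hy'.
    + destruct (ltag_not_rtag t y' y Hy' Ht).
    + rewrite (rtag_inj t y' y); assumption.
Qed.

Lemma pair_inj (p a b c d : M) : pair p a b -> pair p c d -> a = c /\ b = d.
Proof.
  intros Hab Hcd; split; apply mem_ext; intros y.
  - destruct (ltag_exists y) as [t Ht].
    destruct (pair_ltag p a b t y Hab Ht), (pair_ltag p c d t y Hcd Ht); tauto.
  - destruct (rtag_exists y) as [t Ht].
    destruct (pair_rtag p a b t y Hab Ht), (pair_rtag p c d t y Hcd Ht); tauto.
Qed.

Lemma union2_exists (a b : M) : exists u, forall x,
  (x ∈⁺ u <-> x ∈⁺ a \/ x ∈⁺ b) /\ (x ∈⁻ u <-> x ∈⁻ a /\ x ∈⁻ b).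
Proof.
  destruct (upair_exists a b) as [w Hw]; rewrite upairP in Hw.
  destruct (HM _ BZFC_union (fun _ => a) w) as [u Hu]; exists u; intros x.
  destruct (Hu x) as [Hp Hn]; simpl in Hp, Hn; rewrite Hp, Hn; split; split.
  - intros (z & Hz & Hx); apply Hw in Hz; destruct Hz; subst; auto.
  - intros [Hx|Hx]; [exists a|exists b]; split; trivial; apply Hw; auto.
  - intros Hz; split; [destruct (Hz a) as [H|H]|destruct (Hz b) as [H|H]];
      trivial; apply Hw in H; tauto.
  (* For any other [z], membership in [w] is false, since an unordered pair is two-valued. *)
  - intros [Ha Hb] z; destruct (classic (z = a)) as [->|Za]; [auto|].
    destruct (classic (z = b)) as [->|Zb]; [auto|]; left; apply Hw; auto.
Qed.

(** Replacement along each tagging map carries over both truth values of membership; the union of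
    the two images is the pair. *)
Lemma pair_exists (a b : M) : exists p, pair p a b.
Proof.
  destruct (replacement (is_ltag 0 1) (fun _ => a) a) as [u Hu].
  { intros y x x'; exact (ltag_unique x x' y). }
  destruct (replacement (is_rtag 0 1) (fun _ => b) b) as [v Hv].
  { intros y x x'; exact (rtag_unique x x' y). }
  destruct (union2_exists u v) as [p Hp]; exists p; intros x.
  destruct (Hp x) as [-> ->]; destruct (Hu x) as [-> ->], (Hv x) as [-> ->].
  split; [|reflexivity].
  split; (intros [(y & H1 & H2)|(y & H1 & H2)]; [left|right]); exists y;
    split; assumption.
Qed.

(** * Realms and countings *)

(** The realm lies inside a classical superset [c]: truth of membership passes from [a] to [c], and
    falsity passes back. Comprehension then cuts it out of [c]. *)
Lemma rlm_exists (a : M) : exists d, forall x,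
  (x ∈⁺ d <-> rlm x a) /\ (x ∈⁻ d <-> ~ rlm x a).
Proof.
  destruct (HM _ BZFC_classical_superset (fun _ => a) a) as (c & Hc & Hac).
  destruct (comprehension (in_rlm 0 2) (fun _ => a) c) as [d Hd].
  exists d; intros x; specialize (Hd x); specialize (Hc x); specialize (Hac x).
  simpl in Hd, Hc, Hac; unfold rlm.
  destruct (classic (x ∈⁺ a)), (classic (x ∈⁻ a)),  (classic (x ∈⁻ c)); tauto.
Qed.

Definition counting (f a : M) : Prop :=
  (forall p, p ∈⁻ f <-> ~ p ∈⁺ f) /\
  (forall p, p ∈⁺ f -> exists x y, pair p x y) /\
  (forall x y z, maps f x y -> maps f x z -> y = z) /\
  (forall x y z, maps f x z -> maps f y z -> x = y) /\
  (forall x, rlm x a <-> exists y, maps f x y).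

(** The domain is a set term in [is_counting] but a condition on [maps] in [counting]; [rlm_exists]
    supplies the set. *)
Lemma sat_counting (e : nat -> M) (f a : nat) :
  sat_true M e (is_counting f a) <-> counting (e f) (e a).
Proof.
  split.
  - intros (((Hcl & Hpair & Hfun) & Hinj) & d & Hrlm & Hdom).
    repeat split.
    + intros Hn Hp; exact (proj1 (Hcl p) (conj Hp I) Hn).
    + intros Hp; apply NNPP; intros Hn; apply Hp, (Hcl p), Hn.
    + exact Hpair.
    + intros x y z Hy Hz; exact (proj1 (Hfun x y z (conj Hy Hz))).
    + intros x y z Hx Hy; exact (proj1 (Hinj x y z (conj Hx Hy))).
    + intros Hx; apply (Hdom x), (Hrlm x).
      destruct Hx as [Hx|Hx]; [left; exact (conj Hx I)|right; exact Hx].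
    + intros Hx; apply (Hdom x), (Hrlm x) in Hx.
      destruct Hx as [[Hx _]|Hx]; [left|right]; exact Hx.
  - intros (Hcl & Hpair & Hfun & Hinj & Hdom).
    split; [split; [split; [|split]|]|].
    + intros p; split; [intros [Hp _] Hn; exact (proj1 (Hcl p) Hn Hp)|].
      intros Hn; split; [|exact I]; apply NNPP; intros Hp; apply Hn, Hcl, Hp.
    + exact Hpair.
    + intros x y z [Hy Hz]; split; [exact (Hfun x y z Hy Hz)|exact I].
    + intros x y z [Hx Hy]; split; [exact (Hinj x y z Hx Hy)|exact I].
    + destruct (rlm_exists (e a)) as [d Hd]; exists d; split; intros x;
        destruct (Hd x) as [Hp Hn].
      * simpl; rewrite Hp, Hn; unfold rlm; tauto.
      * split; [exact (iff_trans Hp (Hdom x))|].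
        (* Falsity of membership in the domain says that every pair starting with [x] has false
           membership in [f]; as [f] is classical, this means that [x] has no value. *)
        refine (iff_trans Hn _); rewrite Hdom; split.
        -- intros Hx y p Hxy; apply Hcl; intros Hf; apply Hx; exists y, p; auto.
        -- intros Hx (y & p & Hxy & Hf); exact (proj1 (Hcl p) (Hx y p Hxy) Hf).
Qed.

(** Countings can be given by a defining formula: Replacement over the realm sends each [x] to the
    pair of [x] and its value. *)
Lemma counting_exists (p : form) (e : nat -> M) (a : M) :
  let R x y := sat_true M (scons y (scons x e)) p in
  (forall x y z, R x y -> R x z -> y = z) ->
  (forall x y z, rlm x a -> rlm y a -> R x z -> R y z -> x = y) ->
  (forall x, rlm x a -> exists y, R x y) ->
  exists f, counting f a /\ forall x y, maps f x y <-> rlm x a /\ R x y.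
Proof.
  intros R Hfun Hinj Htot; destruct (rlm_exists a) as [d Hd].
  (* [up S] keeps the value at index 0 and makes room for the pair [z] at index 1. *)
  assert (HR : forall x z, sat_true M (scons z (scons x e))
      (Ex (ren (up S) p ∧ is_pair 1 2 0)) <-> exists y, R x y /\ pair z x y).
  { assert (Hr : forall x y z,
      sat_true M (scons y (scons z (scons x e))) (ren (up S) p) <-> R x y)
      by (intros x y z; apply sat_ren; intros [|[|n]]; reflexivity).
    intros x z; split; intros (y & Hy & Hz); exists y; split; try exact Hz;
      apply (Hr x y z), Hy. }
  destruct (replacement (Ex (ren (up S) p ∧ is_pair 1 2 0)) e d) as [f Hf].
  { intros x z z' Hz Hz'; apply HR in Hz, Hz'.
    destruct Hz as (y & Hy & Hz), Hz' as (y' & Hy' & Hz').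
    rewrite (Hfun x y y' Hy Hy') in Hz; exact (pair_unique z z' x y' Hz Hz'). }
  assert (Hmem : forall z, z ∈⁺ f <-> exists x y, rlm x a /\ R x y /\ pair z x y).
  { intros z; destruct (Hf z) as [-> _]; split.
    - intros (x & Hx & Hz); apply HR in Hz; destruct Hz as (y & Hy).
      exists x, y; split; [apply Hd|]; assumption.
    - intros (x & y & Hx & Hy); exists x; split; [apply Hd, Hx|].
      apply HR; exists y; exact Hy. }
  assert (Hmaps : forall x y, maps f x y <-> rlm x a /\ R x y).
  { intros x y; split.
    - intros (z & Hz & Hzf); apply Hmem in Hzf.
      destruct Hzf as (x' & y' & Hx' & Hy' & Hz').
      destruct (pair_inj z x y x' y' Hz Hz') as [-> ->]; auto.
    - intros [Hx Hy]; destruct (pair_exists x y) as [z Hz].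
      exists z; split; [|apply Hmem; exists x, y]; auto. }
  exists f; split; [|exact Hmaps]; split; [|repeat split].
  (* [f] is classical because [d] is: membership of [z] in [f] is false exactly when membership in
     [d] is false for every [x] sent to [z]. *)
  - intros z; split.
    { intros Hn Hp; apply Hmem in Hp; destruct Hp as (x & y & Hx & Hy & Hz).
      apply (Hd x); [|exact Hx]; apply (Hf z); [exact Hn|].
      apply HR; exists y; auto. }
    intros Hp; apply Hf; intros x Hx; apply Hd; intros Hxa.
    apply HR in Hx; destruct Hx as (y & Hy); apply Hp, Hmem; exists x, y; auto.
  - intros z Hz; apply Hmem in Hz; destruct Hz as (x & y & _ & _ & Hz); eauto.
  - intros x y z Hy Hz; apply Hmaps in Hy, Hz; apply (Hfun x); tauto.
  - intros x y z Hx Hy; apply Hmaps in Hx, Hy; apply (Hinj x y z); tauto.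
  - intros Hx; destruct (Htot x Hx) as [y Hy]; exists y; apply Hmaps; auto.
  - intros [y Hy]; apply Hmaps in Hy; tauto.
Qed.

(** * Images under countings, and the truth values of [≅] and [⪯] *)

Definition img_pos (f a y : M) : Prop := exists x, maps f x y /\ x ∈⁺ a.
(** Holds vacuously when [y] is outside the range of [f]. *)
Definition img_neg (f a y : M) : Prop := forall x, maps f x y -> x ∈⁻ a.

Definition image (d f a : M) : Prop :=
  forall y, (y ∈⁺ d <-> img_pos f a y) /\ (y ∈⁻ d <-> img_neg f a y).

Definition img_sub (f a g b : M) : Prop := forall y,
  (img_pos f a y -> img_pos g b y) /\ (img_neg g b y -> img_neg f a y).

Definition img_eq (f a g b : M) : Prop := forall y,
  (img_pos f a y <-> img_pos g b y) /\ (img_neg f a y <-> img_neg g b y).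

(** The falsity of the inclusion, not the negation of [img_sub]: both may hold, and both may
    fail. *)
Definition img_not_sub (f a g b : M) : Prop :=
  exists y, img_pos f a y /\ img_neg g b y.

Definition img_neq (f a g b : M) : Prop :=
  exists y, (img_pos f a y /\ img_neg g b y) \/ (img_neg f a y /\ img_pos g b y).

Lemma image_exists (f a : M) : counting f a -> exists d, image d f a.
Proof.
  intros (_ & _ & Hfun & _).
  destruct (replacement (pair_in 1 0 2) (fun _ => f) a Hfun) as [d Hd].
  exists d; intros y; destruct (Hd y) as [-> ->]; split; [|reflexivity].
  split; intros (x & H1 & H2); exists x; split; assumption.
Qed.

(** Only [is_counting] needs translating; the clauses on images agree with satisfaction by
    conversion. *)
Lemma sat_true_compare (R : form) (e : nat -> M) (a b : nat) :
  sat_true M e (compare R a b) <->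
  exists f g, counting f (e a) /\ counting g (e b) /\
  exists d, image d f (e a) /\ exists d', image d' g (e b) /\
    sat_true M (scons d' (scons d (scons g (scons f e)))) R.
Proof.
  split.
  - intros (f & Hf & g & Hg & H); exists f, g; split; [|split].
    + exact (proj1 (sat_counting (scons f e) 0 (S a)) Hf).
    + exact (proj1 (sat_counting (scons g (scons f e)) 0 (2 + b)) Hg).
    + exact H.
  - intros (f & g & Hf & Hg & H); exists f; split; [|exists g; split].
    + exact (proj2 (sat_counting (scons f e) 0 (S a)) Hf).
    + exact (proj2 (sat_counting (scons g (scons f e)) 0 (2 + b)) Hg).
    + exact H.
Qed.

(** All guards in [compare] are attached by [⊗], so falsity is universal over the countings and the
    images. *)
Lemma sat_false_compare (R : form) (e : nat -> M) (a b : nat) :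
  sat_false M e (compare R a b) <->
  forall f g, counting f (e a) -> counting g (e b) ->
  forall d, image d f (e a) -> forall d', image d' g (e b) ->
    sat_false M (scons d' (scons d (scons g (scons f e)))) R.
Proof.
  split.
  - intros H f g Hf Hg; exact (H f
      (proj2 (sat_counting (scons f e) 0 (S a)) Hf) g
      (proj2 (sat_counting (scons g (scons f e)) 0 (2 + b)) Hg)).
  - intros H f Hf g Hg; exact (H f g
      (proj1 (sat_counting (scons f e) 0 (S a)) Hf)
      (proj1 (sat_counting (scons g (scons f e)) 0 (2 + b)) Hg)).
Qed.

Lemma sat_true_equinum (e : nat -> M) (a b : nat) :
  sat_true M e (a ≅ b) <->
  exists f g, counting f (e a) /\ counting g (e b) /\ img_eq f (e a) g (e b).
Proof.
  unfold equinum; rewrite sat_true_compare; split.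
  - intros (f & g & Hf & Hg & d & Hd & d' & Hd' & E); simpl in E; subst d'.
    exists f, g; split; [|split]; trivial; intros y.
    specialize (Hd y); specialize (Hd' y); tauto.
  - intros (f & g & Hf & Hg & E); exists f, g; split; [|split]; trivial.
    destruct (image_exists f (e a) Hf) as [d Hd]; exists d; split; trivial.
    (* By [E] the image under [f] is also the image under [g], so [d] serves for both. *)
    exists d; split; [|reflexivity]; intros y.
    destruct (Hd y) as [-> ->]; apply E.
Qed.

Lemma sat_false_equinum (e : nat -> M) (a b : nat) :
  sat_false M e (a ≅ b) <->
  forall f g, counting f (e a) -> counting g (e b) -> img_neq f (e a) g (e b).
Proof.
  unfold equinum; rewrite sat_false_compare; split.
  (* The universal statement [H] yields information only once both images are known to exist. *)
  - intros H f g Hf Hg; destruct (image_exists f (e a) Hf) as [d Hd].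
    destruct (image_exists g (e b) Hg) as [d' Hd'].
    specialize (H f g Hf Hg d Hd d' Hd'); apply eq_neg_mem in H.
    destruct H as [y Hy]; exists y; specialize (Hd y); specialize (Hd' y); tauto.
  - intros H f g Hf Hg d Hd d' Hd'; apply eq_neg_mem.
    destruct (H f g Hf Hg) as [y Hy]; exists y.
    specialize (Hd y); specialize (Hd' y); simpl; tauto.
Qed.

Lemma sat_true_dominated (e : nat -> M) (a b : nat) :
  sat_true M e (a ⪯ b) <->
  exists f g, counting f (e a) /\ counting g (e b) /\ img_sub f (e a) g (e b).
Proof.
  unfold dominated; rewrite sat_true_compare; split.
  - intros (f & g & Hf & Hg & d & Hd & d' & Hd' & H); exists f, g.
    split; [|split]; trivial; intros y; specialize (H y).
    specialize (Hd y); specialize (Hd' y); simpl in H; tauto.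
  - intros (f & g & Hf & Hg & H); exists f, g; split; [|split]; trivial.
    destruct (image_exists f (e a) Hf) as [d Hd]; exists d; split; trivial.
    destruct (image_exists g (e b) Hg) as [d' Hd']; exists d'; split; trivial.
    intros y; specialize (Hd y); specialize (Hd' y); specialize (H y).
    simpl; tauto.
Qed.

Lemma sat_false_dominated (e : nat -> M) (a b : nat) :
  sat_false M e (a ⪯ b) <->
  forall f g, counting f (e a) -> counting g (e b) -> img_not_sub f (e a) g (e b).
Proof.
  unfold dominated; rewrite sat_false_compare; split.
  - intros H f g Hf Hg; destruct (image_exists f (e a) Hf) as [d Hd].
    destruct (image_exists g (e b) Hg) as [d' Hd'].
    destruct (H f g Hf Hg d Hd d' Hd') as [y Hy]; exists y.
    specialize (Hd y); specialize (Hd' y); simpl in Hy; tauto.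
  - intros H f g Hf Hg d Hd d' Hd'; destruct (H f g Hf Hg) as [y Hy]; exists y.
    specialize (Hd y); specialize (Hd' y); simpl; tauto.
Qed.

(** * Construction and transfer of countings *)

Lemma counting_id (a : M) : exists f, counting f a.
Proof.
  destruct (counting_exists (0 ≐ 1) (fun _ => a) a) as [f [Hf _]]; simpl;
    eauto; congruence.
Qed.

(** The new counting of [a] is [h ∘ g⁻¹ ∘ f]. *)
Lemma counting_transfer (f g h a b : M) :
  counting f a -> counting g b -> counting h b -> img_sub f a g b ->
  exists k, counting k a /\ img_sub k a h b /\
    (img_sub g b f a -> img_sub h b k a).
Proof.
  intros (_ & _ & Ff & If & Df) (_ & _ & Fg & Ig & Dg) (_ & _ & Fh & Ih & Dh) Hsub.
  set (R x y := exists u v, maps f x u /\ maps g v u /\ maps h v y).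
  (* This makes [h ∘ g⁻¹ ∘ f] total on the realm of [a]. *)
  assert (Hlift : forall x u, rlm x a -> maps f x u ->
      exists v, maps g v u /\ rlm v b).
  { intros x u [Hx|Hx] Hu.
    - destruct (proj1 (Hsub u)) as (v & Hv & Hvb); [exists x; auto|].
      exists v; split; [|left]; assumption.
    (* If [g] sent no point of the realm of [b] to [u], then [u] would be falsely in the image of
       [b], and the falsity half of [Hsub] would make membership of [x] in [a] false. *)
    - apply NNPP; intros Hno; apply Hx, (proj2 (Hsub u)); [|exact Hu].
      intros v Hv; apply NNPP; intros Hvb; apply Hno; exists v; split; trivial.
      right; exact Hvb. }
  destruct (counting_exists
    (Ex (Ex (pair_in 3 1 4 ∧ pair_in 0 1 5 ∧ pair_in 0 2 6)))
    (env3 f g h) a) as [k [Hk Mk]].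
  { intros x y z (u & v & Hu & Hv & Hy) (u' & v' & Hu' & Hv' & Hz).
    rewrite (Ff x u' u Hu' Hu) in Hv'; rewrite (Ig v' v u Hv' Hv) in Hz.
    exact (Fh v y z Hy Hz). }
  { intros x y z _ _ (u & v & Hu & Hv & Hx) (u' & v' & Hu' & Hv' & Hy).
    rewrite (Ih v' v z Hy Hx) in Hv'; rewrite (Fg v u' u Hv' Hv) in Hu'.
    exact (If x y u Hu Hu'). }
  { intros x Hx; destruct (proj1 (Df x) Hx) as [u Hu].
    destruct (Hlift x u Hx Hu) as (v & Hv & Hvb).
    destruct (proj1 (Dh v) Hvb) as [y Hy]; exists y, u, v; exact (conj Hu (conj Hv Hy)). }
  (* The realm condition is absorbed: [R x y] already gives [x] a value under [f]. *)
  assert (Mk' : forall x y, maps k x y <-> R x y).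
  { intros x y; rewrite Mk; split; [intros [_ H]; exact H|].
    intros H; split; [|exact H]; apply Df; destruct H as (u & _ & Hu & _); eauto. }
  clear Mk; exists k; split; [exact Hk|]; split.
  - intros y; split.
    + intros (x & Hxy & Hx); apply Mk' in Hxy; destruct Hxy as (u & v & Hu & Hv & Hy).
      destruct (proj1 (Hsub u)) as (v' & Hv' & Hvb); [exists x; auto|].
      rewrite (Ig v' v u Hv' Hv) in Hvb; exists v; auto.
    + intros Hn x Hxy; apply Mk' in Hxy; destruct Hxy as (u & v & Hu & Hv & Hy).
      apply (proj2 (Hsub u)); [|exact Hu]; intros v' Hv'.
      rewrite (Ig v' v u Hv' Hv); exact (Hn v Hy).
  (* Conversely, the reverse inclusion supplies a preimage under [f] for the value of [g] at a true
     member [v] of [b]; falsity is pulled back along the same points. *)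
  - intros Hsub' y; split.
    + intros (v & Hvy & Hv); destruct (proj1 (Dg v)) as [u Hu]; [left; exact Hv|].
      destruct (proj1 (Hsub' u)) as (x & Hx & Hxa); [exists v; auto|].
      exists x; split; [|exact Hxa]; apply Mk'; exists u, v; auto.
    + intros Hn v Hvy; destruct (proj1 (Dg v)) as [u Hu]; [apply Dh; eauto|].
      apply (proj2 (Hsub' u)); [|exact Hu]; intros x Hx; apply (Hn x), Mk'.
      exists u, v; auto.
Qed.

Lemma img_eq_sym (f a g b : M) : img_eq f a g b -> img_eq g b f a.
Proof. intros H y; specialize (H y); tauto. Qed.

Lemma img_eq_sub (f a g b : M) : img_eq f a g b -> img_sub f a g b.
Proof. intros H y; specialize (H y); tauto. Qed.

(** Equality provides both inclusions, and both are transferred to the same [k]. *)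
Lemma counting_transfer_eq (f g h a b : M) :
  counting f a -> counting g b -> counting h b -> img_eq f a g b ->
  exists k, counting k a /\ img_eq k a h b.
Proof.
  intros Hf Hg Hh E.
  destruct (counting_transfer f g h a b Hf Hg Hh (img_eq_sub _ _ _ _ E))
    as (k & Hk & S1 & S2); exists k; split; [exact Hk|]; intros y.
  specialize (S1 y); specialize (S2 (img_eq_sub _ _ _ _ (img_eq_sym _ _ _ _ E)) y).
  tauto.
Qed.

(** One-sided despite the name: images of [b] are images of [a]. The converse is
    [same_images b a]. *)
Definition same_images (a b : M) : Prop :=
  forall h, counting h b -> exists k, counting k a /\ img_eq k a h b.

Lemma equinum_same_images (e : nat -> M) (a b : nat) :
  sat_true M e (a ≅ b) -> same_images (e a) (e b) /\ same_images (e b) (e a).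
Proof.
  rewrite sat_true_equinum; intros (f & g & Hf & Hg & E).
  split; intros h Hh; [apply (counting_transfer_eq f g)|apply (counting_transfer_eq g f)];
    auto using img_eq_sym.
Qed.

(** * The six clauses: reflexivity, symmetry, congruence and transitivity *)

Lemma equinum_refl (e : nat -> M) (a : nat) : sat_true M e (a ≅ a).
Proof.
  apply sat_true_equinum; destruct (counting_id (e a)) as [f Hf].
  exists f, f; split; [|split]; trivial; intros y; tauto.
Qed.

Lemma equinum_sym (e : nat -> M) (a b : nat) :
  sat_true M e (a ≅ b ⇔ b ≅ a).
Proof.
  change ((sat_true M e (a ≅ b) <-> sat_true M e (b ≅ a)) /\
          (sat_false M e (a ≅ b) <-> sat_false M e (b ≅ a))).
  rewrite !sat_true_equinum, !sat_false_equinum; split; split.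
  1, 2: intros (f & g & Hf & Hg & E); exists g, f; auto using img_eq_sym.
  1, 2: intros H f g Hf Hg; destruct (H g f Hg Hf) as [y Hy]; exists y; tauto.
Qed.

(** Truth exhibits a counting of [a], to be exchanged for one of [b]; falsity ranges over countings
    of [b], each exchanged for one of [a]. Hence [T] and [F] use opposite directions of
    [same_images]. *)
Lemma equinum_congr_l (e : nat -> M) (a b c : nat) :
  sat_true M e (a ≅ b) -> sat_true M e (a ≅ c ⇔ b ≅ c).
Proof.
  assert (T : forall a b, same_images (e b) (e a) ->
    sat_true M e (a ≅ c) -> sat_true M e (b ≅ c)).
  { intros a' b' H; rewrite !sat_true_equinum; intros (f & g & Hf & Hg & E).
    destruct (H f Hf) as (k & Hk & Ek); exists k, g; split; [|split]; trivial.
    intros y; specialize (E y); specialize (Ek y); tauto. }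
  assert (F : forall a b, same_images (e a) (e b) ->
    sat_false M e (a ≅ c) -> sat_false M e (b ≅ c)).
  { intros a' b' H; rewrite !sat_false_equinum; intros Hac f g Hf Hg.
    destruct (H f Hf) as (k & Hk & Ek); destruct (Hac k g Hk Hg) as [y Hy].
    exists y; specialize (Ek y); tauto. }
  intros H; apply equinum_same_images in H; destruct H as [Hab Hba].
  exact (conj (conj (T a b Hba) (T b a Hab)) (conj (F a b Hab) (F b a Hba))).
Qed.

Lemma dominated_congr_l (e : nat -> M) (a b c : nat) :
  sat_true M e (a ≅ b) -> sat_true M e (a ⪯ c ⇔ b ⪯ c).
Proof.
  assert (T : forall a b, same_images (e b) (e a) ->
    sat_true M e (a ⪯ c) -> sat_true M e (b ⪯ c)).
  { intros a' b' H; rewrite !sat_true_dominated; intros (f & g & Hf & Hg & E).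
    destruct (H f Hf) as (k & Hk & Ek); exists k, g; split; [|split]; trivial.
    intros y; specialize (E y); specialize (Ek y); tauto. }
  assert (F : forall a b, same_images (e a) (e b) ->
    sat_false M e (a ⪯ c) -> sat_false M e (b ⪯ c)).
  { intros a' b' H; rewrite !sat_false_dominated; intros Hac f g Hf Hg.
    destruct (H f Hf) as (k & Hk & Ek); destruct (Hac k g Hk Hg) as [y Hy].
    exists y; specialize (Ek y); tauto. }
  intros H; apply equinum_same_images in H; destruct H as [Hab Hba].
  exact (conj (conj (T a b Hba) (T b a Hab)) (conj (F a b Hab) (F b a Hba))).
Qed.

Lemma dominated_congr_r (e : nat -> M) (a b c : nat) :
  sat_true M e (a ≅ b) -> sat_true M e (c ⪯ a ⇔ c ⪯ b).
Proof.
  assert (T : forall a b, same_images (e b) (e a) ->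
    sat_true M e (c ⪯ a) -> sat_true M e (c ⪯ b)).
  { intros a' b' H; rewrite !sat_true_dominated; intros (f & g & Hf & Hg & E).
    destruct (H g Hg) as (k & Hk & Ek); exists f, k; split; [|split]; trivial.
    intros y; specialize (E y); specialize (Ek y); tauto. }
  assert (F : forall a b, same_images (e a) (e b) ->
    sat_false M e (c ⪯ a) -> sat_false M e (c ⪯ b)).
  { intros a' b' H; rewrite !sat_false_dominated; intros Hca f g Hf Hg.
    destruct (H g Hg) as (k & Hk & Ek); destruct (Hca f k Hf Hk) as [y Hy].
    exists y; specialize (Ek y); tauto. }
  intros H; apply equinum_same_images in H; destruct H as [Hab Hba].
  exact (conj (conj (T a b Hba) (T b a Hab)) (conj (F a b Hab) (F b a Hba))).
Qed.

(** The two hypotheses may use different countings [g] and [h] of the middle set; the transfer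
    replaces [f] by a counting [l] whose image lies in that under [h]. *)
Lemma dominated_trans (e : nat -> M) (a b c : nat) :
  sat_true M e (a ⪯ b) -> sat_true M e (b ⪯ c) -> sat_true M e (a ⪯ c).
Proof.
  rewrite !sat_true_dominated; intros (f & g & Hf & Hg & Hab) (h & k & Hh & Hk & Hbc).
  destruct (counting_transfer f g h _ _ Hf Hg Hh Hab) as (l & Hl & Hlh & _).
  exists l, k; split; [|split]; trivial; intros y.
  specialize (Hlh y); specialize (Hbc y); tauto.
Qed.

End InModel.

(* The bound variables A, B, C are the indices 2, 1, 0. *)
Theorem theorem4p3 :
  entails BZFC
    (All (All (All
      (2 ≅ 2
       ∧ (2 ≅ 1 ⇔ 1 ≅ 2)
       ∧ (2 ≅ 1 → (2 ≅ 0 ⇔ 1 ≅ 0))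
       ∧ (2 ≅ 1 → (2 ⪯ 0 ⇔ 1 ⪯ 0))
       ∧ (2 ≅ 1 → (0 ⪯ 2 ⇔ 0 ⪯ 1))
       ∧ (2 ⪯ 1 ∧ 1 ⪯ 0 → 2 ⪯ 0))))).
Proof.
  intros M HM e0 a b c.
  set (e := scons c (scons b (scons a e0))).
  refine (conj (equinum_refl M HM e 2)
    (conj (equinum_sym M HM e 2 1)
    (conj (equinum_congr_l M HM e 2 1 0)
    (conj (dominated_congr_l M HM e 2 1 0)
    (conj (dominated_congr_r M HM e 2 1 0) _))))).
  intros [Hab Hbc]; exact (dominated_trans M HM e 2 1 0 Hab Hbc).
Qed.
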